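(* Let $R$ be a commutative noetherian ring and let $(\mathcal{F},\mathcal{C})$ be a cotorsion pair of $R$-modules. (1) If $F$ is a minimal complex of $R$-modules with $F_i\in \mathcal{F}$ and $\operatorname{im}(\partial_i^F)\in \mathcal{C}$ for all $i\in \mathbb{Z}$, then the canonical surjection $F_i\twoheadrightarrow \operatorname{coker}(\partial_{i+1}^F)$ is an $\mathcal{F}$-precover for all $i\in \mathbb{Z}$ and an $\mathcal{F}$-cover for $i\geq \sup\{j\mid \operatorname{H}_j(F)\neq 0\}$. (2) If $C$ is a minimal complex of $R$-modules with $C^i\in \mathcal{C}$ and $\operatorname{im}(\partial^i_C)\in \mathcal{F}$ for all $i\in \mathbb{Z}$, then the canonical inclusion $\ker(\partial^i_C)\hookrightarrow C^i$ is a $\mathcal{C}$-preenvelope for all $i\in \mathbb{Z}$ and a $\mathcal{C}$-envelope for $i\geq \sup\{j\mid \operatorname{H}^j(C)\neq 0\}$.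
   Context: Homological indexing: $\partial_i^F:F_i\to F_{i-1}$; cohomological indexing: $\partial_C^i:C^i\to C^{i+1}$. Complexes may be unbounded. Classes $\mathcal{F},\mathcal{C}$ of $R$-modules closed under isomorphisms form a cotorsion pair $(\mathcal{F},\mathcal{C})$ if $\mathcal{F}={}^\perp\mathcal{C}$ and $\mathcal{F}^\perp=\mathcal{C}$, where ${}^\perp\mathcal{C}=\{M\mid \operatorname{Ext}^1_R(M,A)=0 \text{ for all } A\in\mathcal{C}\}$ and $\mathcal{F}^\perp=\{N\mid\operatorname{Ext}^1_R(A,N)=0\text{ for all }A\in\mathcal{F}\}$. A complex $D$ is minimal if every homotopy equivalence $\gamma:D\to D$ (degree zero chain map) is an isomorphism of complexes. A morphism $\phi:F\to M$ with $F\in\mathcal{F}$ is an $\mathcal{F}$-precover of $M$ if for every $\phi':F'\to M$ with $F'\in\mathcal{F}$ there is $f:F'\to F$ with $\phi f=\phi'$; it is an $\mathcal{F}$-cover if moreover every endomorphism $f:F\to F$ with $\phi f=\phi$ is an isomorphism. A morphism $\phi:M\to C$ with $C\in\mathcal{C}$ is a $\mathcal{C}$-preenvelope of $M$ if for every $\phi':M\to C'$ with $C'\in\mathcal{C}$ there is $f:C\to C'$ with $f\phi=\phi'$; it is a $\mathcal{C}$-envelope if moreover every endomorphism $f:C\to C$ with $f\phi=\phi$ is an isomorphism. The supremum of the empty set is $-\infty$. The paper assumes throughout that $R$ is commutative and noetherian. *)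

(* Defs.v *)
From HB Require Import structures.
From mathcomp Require Import all_boot all_order all_algebra.
From mathcomp Require Import all_classical constructive_ereal.

Set Implicit Arguments.
Unset Strict Implicit.
Unset Printing Implicit Defensive.

Import GRing.Theory.
Local Open Scope ring_scope.
Local Open Scope quotient_scope.

(* Ideals are the submodules of the regular module [R^o]. *)
Definition noetherian (R : comPzRingType) : Prop :=
  forall I : nat -> submodClosed R^o,
    (forall n, {subset I n <= I n.+1}) ->
    exists n, forall m, (n <= m)%N -> I m =i I n.

Section SubQuotient.
Variables (R : comPzRingType) (V : lmodType R).

Definition submod (S : submodClosed V) : Type := {x : V | x \in S}.

HB.instance Definition _ (S : submodClosed V) := SubChoice.on (submod S).
HB.instance Definition _ (S : submodClosed V) :=
  [SubChoice_isSubLmodule of submod S by <:].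

Definition submod_incl (S : submodClosed V) : {linear submod S -> V} := val.

(* [Quotient.quot] is the library's quotient of an additive group; only the
   scalar multiplication is new. It expects a [zmodClosed], which [submodClosed]
   does not inherit from, closure under opposite being derived. *)
Definition submod_zmod (S : submodClosed V) : {pred V} := fun x => x \in S.

Lemma submod_zmod_closed (S : submodClosed V) : zmod_closed (submod_zmod S).
Proof. exact: GRing.subsemimod_closedB (GRing.subsemimodClosedP S). Qed.

HB.instance Definition _ (S : submodClosed V) :=
  GRing.isZmodClosed.Build V (submod_zmod S) (submod_zmod_closed S).

Definition submod_zmodClosed (S : submodClosed V) : zmodClosed V :=
  submod_zmod S.

Definition quotmod (S : submodClosed V) : Type :=
  Quotient.quot (submod_zmodClosed S).

HB.instance Definition _ (S : submodClosed V) := GRing.Zmodule.on (quotmod S).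

Section Scale.
Variable S : submodClosed V.
Let Q := Quotient.quot (submod_zmodClosed S).

Definition quotmod_scale (a : R) (q : quotmod S) : quotmod S :=
  \pi_Q (a *: repr q).

Lemma quotmod_scale_pi a (x : V) :
  quotmod_scale a (\pi_Q x) = \pi_Q (a *: x).
Proof.
apply/eqP; rewrite /quotmod_scale -Quotient.idealrBE -scalerBr.
have : repr (\pi_Q x) - x \in submod_zmodClosed S by rewrite Quotient.idealrBE reprK.
by rewrite !unfold_in; apply: rpredZ.
Qed.

Lemma quotmod_scaleA a b q :
  quotmod_scale a (quotmod_scale b q) = quotmod_scale (a * b) q.
Proof.
by rewrite -[q]reprK (quotmod_scale_pi b) !quotmod_scale_pi scalerA.
Qed.

Lemma quotmod_scale1 : left_id 1 quotmod_scale.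
Proof. by move=> q; rewrite -[q]reprK quotmod_scale_pi scale1r. Qed.

Lemma quotmod_scaleDr : right_distributive quotmod_scale +%R.
Proof.
move=> a p q; rewrite -[p]reprK -[q]reprK.
by rewrite -raddfD !quotmod_scale_pi -raddfD scalerDr.
Qed.

Lemma quotmod_scaleDl q : {morph quotmod_scale^~ q : a b / a + b}.
Proof.
by move=> a b; rewrite -[q]reprK !quotmod_scale_pi -raddfD scalerDl.
Qed.

HB.instance Definition _ := GRing.Zmodule_isLmodule.Build R (quotmod S)
  quotmod_scaleA quotmod_scale1 quotmod_scaleDr quotmod_scaleDl.

Definition quotmod_proj_fun (x : V) : quotmod S := \pi_Q x.

Lemma quotmod_proj_is_linear : linear quotmod_proj_fun.
Proof.
by move=> a x y; rewrite /quotmod_proj_fun raddfD /= -quotmod_scale_pi.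
Qed.

HB.instance Definition _ :=
  GRing.isLinear.Build R V (quotmod S) *:%R quotmod_proj_fun
    quotmod_proj_is_linear.

Definition quotmod_proj : {linear V -> quotmod S} := quotmod_proj_fun.

End Scale.
End SubQuotient.

Section KernelImage.
Variables (R : comPzRingType) (V W : lmodType R) (f : {linear V -> W}).

Definition ker_pred : {pred V} := fun x => f x == 0.

Lemma ker_pred_submod : submod_closed ker_pred.
Proof.
split=> [|a x y]; rewrite !unfold_in /ker_pred ?linear0 // => /eqP fx /eqP fy.
by rewrite linearP fx fy scaler0 addr0.
Qed.

HB.instance Definition _ :=
  GRing.isSubmodClosed.Build R V ker_pred ker_pred_submod.

Definition im_pred : {pred W} := fun y => `[< exists x, f x = y >].

Lemma im_pred_submod : submod_closed im_pred.
Proof.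
split=> [|a y z]; first by apply/asboolP; exists 0; rewrite linear0.
move=> /asboolP[x <-] /asboolP[x' <-].
by apply/asboolP; exists (a *: x + x'); rewrite linearP.
Qed.

HB.instance Definition _ :=
  GRing.isSubmodClosed.Build R W im_pred im_pred_submod.

Definition kermod : lmodType R := submod ker_pred.
Definition immod : lmodType R := submod im_pred.
Definition cokermod : lmodType R := quotmod im_pred.

Definition ker_incl : {linear kermod -> V} := submod_incl ker_pred.
Definition coker_proj : {linear W -> cokermod} := quotmod_proj im_pred.

End KernelImage.

Section Homology.
Variables (R : comPzRingType) (U V W : lmodType R).
Variables (f : {linear U -> V}) (g : {linear V -> W}).

(* [im f] as a submodule of [ker g]; forming its preimage along the inclusion
   of [ker g] avoids carrying a proof of [g \o f = 0]. *)
Definition bound_pred : {pred kermod g} := fun z => ker_incl g z \in im_pred f.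

Lemma bound_pred_submod : submod_closed bound_pred.
Proof.
have inE z : (z \in bound_pred) = (ker_incl g z \in im_pred f) by [].
split=> [|a x y]; rewrite !inE; first by rewrite linear0 rpred0.
by move=> fx fy; rewrite linearP rpredD // rpredZ.
Qed.

HB.instance Definition _ :=
  GRing.isSubmodClosed.Build R (kermod g) bound_pred bound_pred_submod.

Definition homology : lmodType R := quotmod bound_pred.

End Homology.

Section HomModule.
Variables (R : comPzRingType) (A : lmodType R).

Section Def.
Variable V : lmodType R.

Definition lin_pred : {pred (V -> A)} := fun h => `[< linear h >].

Lemma lin_pred_submod : submod_closed lin_pred.
Proof.
split=> [|a g h]; first by apply/asboolP=> b x y /=; rewrite scaler0 addr0.
move=> /asboolP lg /asboolP lh; apply/asboolP=> b x y.
rewrite -[LHS]/(a *: g (b *: x + y) + h (b *: x + y)) lg lh.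
rewrite -[RHS]/(b *: (a *: g x + h x) + (a *: g y + h y)).
by rewrite !scalerDr !scalerA (mulrC a b) addrACA.
Qed.

HB.instance Definition _ :=
  GRing.isSubmodClosed.Build R (V -> A) lin_pred lin_pred_submod.

Definition Hommod : lmodType R := submod lin_pred.

End Def.

Variables (V W : lmodType R) (u : {linear V -> W}).

Lemma precomp_lin (h : Hommod W) : val h \o u \in @lin_pred V.
Proof.
apply/asboolP=> a x y /=; rewrite linearP.
by have /asboolP -> := valP h.
Qed.

Definition precomp_fun (h : Hommod W) : Hommod V :=
  Sub (val h \o u) (precomp_lin h).

Lemma precomp_is_linear : linear precomp_fun.
Proof. by move=> a g h; apply: val_inj; apply/funext. Qed.

HB.instance Definition _ :=
  GRing.isLinear.Build R (Hommod W) (Hommod V) *:%R precomp_fun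
    precomp_is_linear.

Definition precomp : {linear Hommod W -> Hommod V} := precomp_fun.

End HomModule.

Section FreeModule.
Variables (R : comPzRingType) (X : choiceType).

Definition fsupp (c : X -> R^o) : set X := [set x | c x != 0].

Definition fsupp_pred : {pred (X -> R^o)} :=
  fun c => `[< finite_set (fsupp c) >].

Lemma fsupp_pred_submod : submod_closed fsupp_pred.
Proof.
split=> [|a c d].
  apply/asboolP; rewrite (_ : fsupp _ = set0) //.
  by apply/seteqP; split=> x //=; rewrite /fsupp /= eqxx.
move=> /asboolP fc /asboolP fd; apply/asboolP.
apply: (@sub_finite_set _ _ (fsupp c `|` fsupp d)%classic).
  move=> x; rewrite /fsupp /=; case: (eqVneq (c x) 0) => [c0|]; last by left.
  case: (eqVneq (d x) 0) => [d0|]; last by right.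
  by rewrite -[(_ + _) x]/(a *: c x + d x) c0 d0 scaler0 addr0 eqxx.
by rewrite finite_setU.
Qed.

HB.instance Definition _ :=
  GRing.isSubmodClosed.Build R (X -> R^o) fsupp_pred fsupp_pred_submod.

Definition free_module : lmodType R := submod fsupp_pred.

End FreeModule.

Section FreeLift.
Variables (R : comPzRingType) (X : choiceType) (N : lmodType R) (g : X -> N).

Definition free_lift_fun (c : free_module R X) : N :=
  \sum_(x \in fsupp (val c)) (val c x : R) *: g x.

Lemma free_liftE (c : free_module R X) (s : seq X) :
  uniq s -> (forall x, val c x != 0 -> x \in s) ->
  free_lift_fun c = \sum_(x <- s) (val c x : R) *: g x.
Proof.
move=> us sub; rewrite /free_lift_fun.
apply: fsbig_fwiden => // x [_ /negP].
by rewrite negbK => /eqP /= ->; rewrite scale0r.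
Qed.

Lemma free_lift_is_linear : linear free_lift_fun.
Proof.
move=> a c d.
have [s us cds] : exists2 s : seq X, uniq s &
    forall x, (val c x != 0) || (val d x != 0) -> x \in s.
  have /asboolP fc := valP c.
  have /asboolP fd := valP d.
  have /finite_seqP[s sE] : finite_set (fsupp (val c) `|` fsupp (val d))%classic.
    by rewrite finite_setU.
  exists (undup s); first exact: undup_uniq.
  move=> x cdx; rewrite mem_undup.
  have : (fsupp (val c) `|` fsupp (val d))%classic x.
    by case/orP: cdx; [left|right].
  by rewrite sE.
have cdE x : val (a *: c + d) x = a * val c x + val d x by [].
rewrite !(free_liftE us); last 3 first.
- by move=> x dx; rewrite cds // dx orbT.
- by move=> x cx; rewrite cds // cx.
- move=> x; rewrite cdE => cdx; apply: cds; apply: contraR cdx.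
  by rewrite negb_or !negbK => /andP[/eqP -> /eqP ->]; rewrite mulr0 addr0.
rewrite scaler_sumr -big_split /=; apply: eq_bigr => x _.
by rewrite [X in X *: _ = _]cdE scalerDl scalerA.
Qed.

HB.instance Definition _ :=
  GRing.isLinear.Build R (free_module R X) N *:%R free_lift_fun
    free_lift_is_linear.

Definition free_lift : {linear free_module R X -> N} := free_lift_fun.

End FreeLift.

Definition free_eval (R : comPzRingType) (M : lmodType R) :
    {linear free_module R M -> M} := free_lift (fun x : M => x).

(* The standard free resolution of [M]: its [n]-th term is the free module on
   the underlying set of the [n]-th syzygy. *)
Fixpoint syzygy (R : comPzRingType) (M : lmodType R) (n : nat) : lmodType R :=
  if n is m.+1 then kermod (free_eval (syzygy M m)) else M.

Definition res_obj (R : comPzRingType) (M : lmodType R) (n : nat) : lmodType R :=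
  free_module R (syzygy M n).

Definition res_diff (R : comPzRingType) (M : lmodType R) (n : nat) :
    {linear res_obj M n.+1 -> res_obj M n} :=
  ker_incl (free_eval (syzygy M n)) \o free_eval (syzygy M n.+1).

(* First right derived functor of [Hom(-, A)] at [M]. *)
Definition Ext1 (R : comPzRingType) (M A : lmodType R) : lmodType R :=
  homology (precomp A (res_diff M 0)) (precomp A (res_diff M 1)).

Definition zero_module (R : comPzRingType) (M : lmodType R) : Prop :=
  forall x : M, x = 0.

Definition module_class (R : comPzRingType) := lmodType R -> Prop.

Definition iso_closed (R : comPzRingType) (K : module_class R) : Prop :=
  forall (M N : lmodType R) (f : {linear M -> N}), bijective f -> K M -> K N.

Definition left_perp (R : comPzRingType) (C : module_class R) : module_class R :=
  fun M => forall A, C A -> zero_module (Ext1 M A).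

Definition right_perp (R : comPzRingType) (F : module_class R) : module_class R :=
  fun N => forall A, F A -> zero_module (Ext1 A N).

Definition cotorsion_pair (R : comPzRingType) (F C : module_class R) : Prop :=
  [/\ iso_closed F, iso_closed C,
      forall M, F M <-> left_perp C M &
      forall N, right_perp F N <-> C N].

Definition is_precover (R : comPzRingType) (F : module_class R)
    (P M : lmodType R) (phi : {linear P -> M}) : Prop :=
  F P /\ forall (P' : lmodType R) (phi' : {linear P' -> M}), F P' ->
    exists f : {linear P' -> P}, forall x, phi (f x) = phi' x.

Definition is_cover (R : comPzRingType) (F : module_class R)
    (P M : lmodType R) (phi : {linear P -> M}) : Prop :=
  is_precover F phi /\
  forall f : {linear P -> P}, (forall x, phi (f x) = phi x) -> bijective f.

Definition is_preenvelope (R : comPzRingType) (C : module_class R)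
    (M Q : lmodType R) (phi : {linear M -> Q}) : Prop :=
  C Q /\ forall (Q' : lmodType R) (phi' : {linear M -> Q'}), C Q' ->
    exists f : {linear Q -> Q'}, forall x, f (phi x) = phi' x.

Definition is_envelope (R : comPzRingType) (C : module_class R)
    (M Q : lmodType R) (phi : {linear M -> Q}) : Prop :=
  is_preenvelope C phi /\
  forall f : {linear Q -> Q}, (forall x, f (phi x) = phi x) -> bijective f.

(* Complexes with differential of degree [e]. A linear map [cdiff i j] is given
   for all [i] and [j] but vanishes unless [j = i + e]; this avoids transporting
   along equalities of degrees. *)
Record complex (R : comPzRingType) (e : int) := Complex {
  cobj :> int -> lmodType R;
  cdiff : forall i j, {linear cobj i -> cobj j};
  cdiff_shape : forall i j x, j != i + e -> cdiff i j x = 0;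
  cdiff_cdiff : forall i j k x, cdiff j k (cdiff i j x) = 0
}.

Definition chain_complex (R : comPzRingType) := complex R (- 1).
Definition cochain_complex (R : comPzRingType) := complex R 1.

Section ComplexTheory.
Variables (R : comPzRingType) (e : int).
Implicit Types X Y Z : complex R e.

Record chain_map X Y := ChainMap {
  cmap :> forall i, {linear X i -> Y i};
  cmap_comm : forall i j x, cmap j (cdiff X i j x) = cdiff Y i j (cmap i x)
}.

Definition chain_id X : chain_map X X :=
  @ChainMap X X (fun i => idfun) (fun i j x => erefl).

Lemma chain_comp_comm X Y Z (g : chain_map Y Z) (f : chain_map X Y) i j x :
  g j (f j (cdiff X i j x)) = cdiff Z i j (g i (f i x)).
Proof. by rewrite !cmap_comm. Qed.

Definition chain_comp X Y Z (g : chain_map Y Z) (f : chain_map X Y) :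
    chain_map X Z :=
  @ChainMap X Z (fun i => g i \o f i) (chain_comp_comm g f).

(* Only the components [s i (i - e)] of the family [s] play a role. *)
Definition homotopic X Y (f g : chain_map X Y) : Prop :=
  exists s : forall i j, {linear X i -> Y j}, forall i x,
    f i x - g i x =
      cdiff Y (i - e) i (s i (i - e) x) + s (i + e) i (cdiff X i (i + e) x).

Definition homotopy_equivalence X Y (f : chain_map X Y) : Prop :=
  exists g : chain_map Y X,
    homotopic (chain_comp g f) (chain_id X) /\
    homotopic (chain_comp f g) (chain_id Y).

Definition chain_isomorphism X Y (f : chain_map X Y) : Prop :=
  exists g : chain_map Y X,
    (forall i, cancel (f i) (g i)) /\ (forall i, cancel (g i) (f i)).

Definition minimal X : Prop :=
  forall f : chain_map X X, homotopy_equivalence f -> chain_isomorphism f.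

(* [H_i(X)] for chain complexes, [H^i(X)] for cochain complexes. *)
Definition complex_homology X (i : int) : lmodType R :=
  homology (cdiff X (i - e) i) (cdiff X i (i + e)).

(* The supremum in [int] extended by [-oo] and [+oo]. *)
Definition homology_sup X : \bar int :=
  supremum (-oo)%E
    [set (j%:E)%E | j in
       [set j | ~ zero_module (complex_homology X j)]]%classic.

End ComplexTheory.

(* Main.v *)
Require Import Defs.
From HB Require Import structures.
From mathcomp Require Import all_boot all_order all_algebra.
From mathcomp Require Import all_classical constructive_ereal.
Local Open Scope ring_scope.

(** Over a cotorsion pair [(F, C)], every [Ext^1(M, A)] with [M] in [F] and [A]
in [C] vanishes, and a vanishing [Ext^1] solves lifting problems against
surjections with kernel [A] and extension problems along injections with
cokernel [M]. Lifting along [X_i -> coker d_{i+1}], whose kernel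
[im d_{i+1}] is in [C], gives the precovers ([coker_precover]); extending along
[ker d^i -> Y^i], whose cokernel is [im d^i] in [F], gives the preenvelopes
([ker_preenvelope]).

For the covers, let [f] be an endomorphism of [X_i] over [coker d_{i+1}]. Then
[f - 1] takes values in [im d_{i+1}]. If the homology vanishes in degree
[i + 1], the kernel of [d_{i+1}] is [im d_{i+2}], which is in [C], so [f - 1] lifts to
[s : X_i -> X_{i+1}] with [d s = f - 1] ([lift_exact]). The single map [s],
regarded as a homotopy, yields the chain map [1 + d s + s d]. It is homotopic to
the identity, hence an isomorphism since [X] is minimal, and its component in
degree [i] is [1 + d s = f], the term [s d] there involving only the zero
component of the homotopy out of degree [i - 1]. The envelopes are dual: [f - 1]
vanishes on [ker d^i], hence equals [s d] for some [s : Y^{i+1} -> Y^i]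
([extend_exact]), and [1 + s d] is the component in degree [i] of an
automorphism.

The two halves are proved for complexes with differential of arbitrary nonzero
degree [e]; the covers are the case [e = -1] and the envelopes the case
[e = 1]. *)

Set Implicit Arguments.
Unset Strict Implicit.
Unset Printing Implicit Defensive.
Import Order.TTheory GRing.Theory Num.Theory.

(** * Lifting and extension problems governed by [Ext1] *)

Section Linear.
Variable R : comPzRingType.

(** Maps obtained by a diagram chase are only specified up to choices of
preimages; this turns such a specification into a linear map, additivity and
well-definedness being reduced to single-valuedness at [0]. *)
Lemma linear_of_relation (V W : lmodType R) (T : V -> W -> Prop) :
  (forall x, exists y, T x y) ->
  (forall a x y x' y', T x y -> T x' y' -> T (a *: x + x') (a *: y + y')) ->
  (forall y, T 0 y -> y = 0) ->
  exists f : {linear V -> W}, forall x, T x (f x).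
Proof.
move=> /choice[f Tf] Tlin T0.
have flin : linear f.
  move=> a x y; apply/eqP; rewrite -subr_eq0; apply/eqP/T0.
  have := Tlin (-1) _ _ _ _ (Tlin a _ _ _ _ (Tf x) (Tf y)) (Tf (a *: x + y)).
  by rewrite !scaleN1r addNr [- _ + f _]addrC.
pose fL := GRing.isLinear.Build R V W *:%R f flin.
by exists (HB.pack_for {linear V -> W} f fL).
Qed.

Lemma free_lift_comp (X : choiceType) (V W : lmodType R) (f : {linear V -> W})
    (g : X -> V) (c : free_module R X) :
  f (free_lift g c) = free_lift (f \o g) c.
Proof.
have /asboolP/finite_seqP[s sE] := valP c.
have cs x : val c x != 0 -> x \in undup s.
  by move=> cx; rewrite mem_undup; have : fsupp (val c) x by []; rewrite sE.
rewrite /free_lift/= !(free_liftE _ (undup_uniq s) cs) linear_sum.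
by apply: eq_bigr => x _; rewrite linearZ.
Qed.

Lemma free_eval_surj (M : lmodType R) (m : M) : exists c, free_eval M c = m.
Proof.
(* The basis element of the free module at [m]. *)
pose d : M -> R^o := fun x => (x == m)%:R.
have dm x : d x != 0 -> x \in [:: m].
  by rewrite inE /d; case: (x == m); rewrite // eqxx.
have dP : d \in @fsupp_pred R M.
  apply/asboolP; exact: (@sub_finite_set _ _ [set` [:: m]]%classic).
exists (Sub d dP).
by rewrite /free_eval /free_lift/= (@free_liftE _ _ _ _ _ [:: m]) //
  big_seq1 /= /d eqxx scale1r.
Qed.

Lemma quotmod_proj_eq0 (V : lmodType R) (S : submodClosed V) (x : V) :
  quotmod_proj S x = 0 <-> x \in S.
Proof.
have -> : (x \in S) = (x - 0 \in submod_zmodClosed S) by rewrite subr0.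
rewrite Quotient.idealrBE -[0 in X in X <-> _](linear0 (quotmod_proj S)).
by split=> [/eqP|/eqP].
Qed.

Lemma homology_zero_exact (U V W : lmodType R) (f : {linear U -> V})
    (g : {linear V -> W}) :
  zero_module (homology f g) -> forall x, g x = 0 -> exists y, f y = x.
Proof.
move=> H0 x /eqP gx.
have kx : x \in ker_pred g by [].
have /quotmod_proj_eq0 :=
  H0 (quotmod_proj (@bound_pred _ _ _ _ f g) (Sub x kx)).
by move=> /asboolP.
Qed.

Lemma ker_inclK (V W : lmodType R) (f : {linear V -> W}) (z : kermod f) :
  f (ker_incl f z) = 0.
Proof. by apply/eqP; apply: (valP z). Qed.

(** This replaces the second step of the free resolution by the first syzygy:
a 1-cocycle is a map on [res_obj M 1] killing the relations between the
generators of [kermod (free_eval M)], that is, a map on this kernel, and it is a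
coboundary when the latter extends to [res_obj M 0]. *)
Lemma Ext1_zero_extend (M A : lmodType R) :
  zero_module (Ext1 M A) ->
  forall h : {linear kermod (free_eval M) -> A},
  exists k : {linear res_obj M 0 -> A},
    forall z, k (ker_incl (free_eval M) z) = h z.
Proof.
move=> /homology_zero_exact E h.
pose c := h \o free_eval (kermod (free_eval M)).
have cP : (c : res_obj M 1 -> A) \in @lin_pred R A (res_obj M 1).
  by apply/asboolP => a x y; rewrite /c /= !linearP.
have [|k kE] := E (Sub (c : res_obj M 1 -> A) cP).
  apply: val_inj; apply/funext => x.
  rewrite -[LHS]/(h (free_eval (syzygy M 1) (res_diff M 1 x))).
  by rewrite ker_inclK linear0.
have /asboolP klin := valP k.
pose kL := GRing.isLinear.Build R (res_obj M 0) A *:%R (val k) klin.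
exists (HB.pack_for {linear res_obj M 0 -> A} (val k) kL) => z.
have [x <-] := free_eval_surj z.
exact: (congr1 (fun u : Hommod A (res_obj M 1) => val u x) kE).
Qed.

(** Compose [g] with a free presentation of [M] and lift the composite to
[G : res_obj M 0 -> P]. On the relations of [M], [G] lands in [immod j], and the
vanishing of [Ext1] extends this restriction to all of [res_obj M 0];
subtracting the extension makes [G] descend to [M]. Asking only for exactness at
[P] and for [g] to land in the image of [p] makes the lemma applicable
to a differential as well as to a cokernel projection. *)
Lemma lift_exact (M U P Q : lmodType R) (j : {linear U -> P})
    (p : {linear P -> Q}) (g : {linear M -> Q}) :
  zero_module (Ext1 M (immod j)) ->
  (forall x, p x = 0 <-> exists u, j u = x) ->
  (forall m, exists x, p x = g m) ->
  exists f : {linear M -> P}, forall m, p (f m) = g m.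
Proof.
move=> /Ext1_zero_extend E ex /choice[l lE].
pose G : {linear res_obj M 0 -> P} := free_lift l.
have pG y : p (G y) = g (free_eval M y).
  by rewrite !free_lift_comp; congr (free_lift _ y); apply/funext.
pose incl : {linear immod j -> P} := submod_incl (im_pred j).
have [h hE] : exists h : {linear kermod (free_eval M) -> immod j},
    forall z, incl (h z) = G (ker_incl (free_eval M) z).
  apply: (linear_of_relation
    (T := fun z w => incl w = G (ker_incl (free_eval M) z)))
    => [z|a x y x' y' xy xy'|y].
  - have /ex jz : p (G (ker_incl (free_eval M) z)) = 0.
      by rewrite pG ker_inclK linear0.
    by exists (Sub (G (ker_incl (free_eval M) z)) (asboolT jz)).
  - by rewrite !linearP xy xy'.
  - by rewrite !linear0 => y0; apply: val_inj.
have [k kE] := E h.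
have p_incl (w : immod j) : p (incl w) = 0.
  by apply/ex; have /asboolP := valP w.
have [f fE] : exists f : {linear M -> P}, forall m,
    exists y, free_eval M y = m /\ f m = G y - incl (k y).
  apply: (linear_of_relation
    (T := fun m x => exists y, free_eval M y = m /\ x = G y - incl (k y)))
    => [m|a x y x' y'|].
  - by have [y <-] := free_eval_surj m; exists (G y - incl (k y)); exists y.
  - move=> [v [<- ->]] [v' [<- ->]]; exists (a *: v + v'); split.
      by rewrite linearP.
    by rewrite !linearP scalerDr addrACA.
  - move=> _ [y [/eqP y0 ->]]; have yk : y \in ker_pred (free_eval M) by [].
    by have := kE (Sub y yk); rewrite [ker_incl _ _]/= => ->; rewrite hE subrr.
exists f => m; have [y [<- ->]] := fE m.
by rewrite linearB /= p_incl subr0 pG.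
Qed.

(** Lift a free presentation of [immod q] to [G : res_obj (immod q) 0 -> B].
Then [B] is generated by the images of [G] and [u], subject to the
identification of [G] on the relations of [immod q] with a map into the image of [u]. The
vanishing of [Ext1] provides [k] compatible with [h] under this identification,
and [G y + u v |-> k y + h v] is the extension. *)
Lemma extend_exact (U B W A : lmodType R) (u : {linear U -> B})
    (q : {linear B -> W}) (h : {linear U -> A}) :
  zero_module (Ext1 (immod q) A) ->
  (forall x, q x = 0 <-> exists v, u v = x) ->
  (forall v, u v = 0 -> h v = 0) ->
  exists f : {linear B -> A}, forall v, f (u v) = h v.
Proof.
set M := immod q => /Ext1_zero_extend E ex uh.
pose incl : {linear M -> W} := submod_incl (im_pred q).
have /choice[l lE] : forall m, exists b, q b = incl m.
  by move=> m; have /asboolP := valP m.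
pose G : {linear res_obj M 0 -> B} := free_lift l.
have qG y : q (G y) = incl (free_eval M y).
  by rewrite !free_lift_comp; congr (free_lift _ y); apply/funext.
have [h' h'E] : exists h' : {linear kermod (free_eval M) -> A},
    forall z, exists v, u v = G (ker_incl (free_eval M) z) /\ h' z = h v.
  apply: (linear_of_relation (T := fun z w =>
    exists v, u v = G (ker_incl (free_eval M) z) /\ w = h v))
    => [z|a x y x' y'|].
  - have /ex[v vE] : q (G (ker_incl (free_eval M) z)) = 0.
      by rewrite qG ker_inclK.
    by exists (h v), v.
  - move=> [v [uv ->]] [v' [uv' ->]]; exists (a *: v + v').
    by rewrite !linearP uv uv'.
  - by move=> _ [v [+ ->]]; rewrite linear0 => /uh.
have [k kE] := E h'.
have qu x : q (u x) = 0 by apply/ex; exists x.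
(* The value [k y + h v] depends only on [G y + u v]: this makes the relation
   below single-valued and its function agree with [h] along [u]. *)
have key y v w : u w = G y + u v -> k y + h v = h w.
  move=> e; have y0 : free_eval M y = 0.
    by apply: val_inj; have := qu w; rewrite e linearD /= qu addr0 qG.
  have yk : y \in ker_pred (free_eval M) by apply/eqP.
  have := kE (Sub y yk); have [w' [uw' ->]] := h'E (Sub y yk); rewrite /= => ->.
  rewrite -linearD; apply/eqP; rewrite -subr_eq0 -linearB; apply/eqP/uh.
  by rewrite linearB linearD /= uw' -e subrr.
have [f fE] : exists f : {linear B -> A}, forall b,
    exists y v, b = G y + u v /\ f b = k y + h v.
  apply: (linear_of_relation (T := fun b w =>
    exists y v, b = G y + u v /\ w = k y + h v)) => [b|a x y x' y'|].
  - have qb : q b \in im_pred q by apply/asboolP; exists b.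
    have [y yE] := free_eval_surj (Sub (q b) qb : M).
    have /ex[v vE] : q (b - G y) = 0 by rewrite linearB /= qG yE subrr.
    by exists (k y + h v), y, v; rewrite vE addrC subrK.
  - move=> [y1 [v1 [-> ->]]] [y2 [v2 [-> ->]]].
    exists (a *: y1 + y2), (a *: v1 + v2).
    by rewrite !linearP !scalerDr; split; rewrite addrACA.
  - by move=> _ [y [v [e ->]]]; rewrite (key y v 0) ?linear0.
by exists f => v; have [y [w [e ->]]] := fE (u v); apply: key.
Qed.

End Linear.

(** * Automorphisms of minimal complexes *)

Section Complexes.
Variables (R : comPzRingType) (e : int).
Implicit Type X : complex R e.

(** The maps [1 + d s + s d] form a chain map homotopic to the identity, so it
is a homotopy equivalence with the identity as homotopy inverse. *)
Lemma minimal_homotopy_bij X (s : forall i j, {linear X i -> X j}) (i : int) :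
  minimal X ->
  bijective (fun x => x + (cdiff X (i - e) i (s i (i - e) x)
                           + s (i + e) i (cdiff X i (i + e) x))).
Proof.
move=> minX.
pose t i x := cdiff X (i - e) i (s i (i - e) x)
              + s (i + e) i (cdiff X i (i + e) x).
have flin i' : linear (fun x => x + t i' x).
  move=> a x y; have -> : t i' (a *: x + y) = a *: t i' x + t i' y.
    by rewrite /t !linearP scalerDr addrACA.
  by rewrite (scalerDr a x) addrACA.
pose fL i' := GRing.isLinear.Build R (X i') (X i') *:%R
  (fun x => x + t i' x) (flin i').
pose f i' := HB.pack_for {linear X i' -> X i'} (fun x => x + t i' x) (fL i').
have fC i' j x : f j (cdiff X i' j x) = cdiff X i' j (f i' x).
  rewrite /f /= /t; have [->|ij] := eqVneq j (i' + e); last first.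
    by rewrite !(cdiff_shape _ ij) !linear0 !addr0.
  rewrite !linearD /= !cdiff_cdiff linear0 addr0 add0r.
  by rewrite addrK.
have [|g [fg gf]] := minX (ChainMap fC); last exact: Bijective (fg i) (gf i).
by exists (chain_id X); split; exists s => i' x /=; rewrite addrC addKr.
Qed.

(** This is how a homotopy concentrated in one degree is built: the equality
tests on degrees transport [s0] to the types [X i] and [X j]. *)
Lemma single_homotopy X (a b : int) (s0 : {linear X a -> X b}) :
  exists2 s : forall i j, {linear X i -> X j},
    s a b = s0 & forall i j x, i != a -> s i j x = 0.
Proof.
pose s i j : {linear X i -> X j} :=
  match pselect (a = i), pselect (b = j) with
  | left p, left q =>
    eq_rect a (fun i => {linear X i -> X j})
      (eq_rect b (fun j => {linear X a -> X j}) s0 j q) i p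
  | _, _ => \0
  end.
exists s => [|i j x].
  rewrite /s; case: pselect => // p; case: pselect => // q.
  by rewrite (eq_irrelevance p erefl) (eq_irrelevance q erefl).
by rewrite /s; case: pselect => // ai /eqP[].
Qed.

Lemma minimal_bij_out X i (s : {linear X i -> X (i - e)}) :
  e != 0 -> minimal X -> bijective (fun x => x + cdiff X (i - e) i (s x)).
Proof.
move=> e0 minX; have [t ts t0] := single_homotopy s.
apply: (eq_bij (minimal_homotopy_bij t i minX)) => x /=.
by rewrite ts t0 ?addr0 // -subr_eq0 addrAC subrr add0r.
Qed.

Lemma minimal_bij_in X i (s : {linear X (i + e) -> X i}) :
  e != 0 -> minimal X -> bijective (fun x => x + s (cdiff X i (i + e) x)).
Proof.
move=> e0 minX; have [t ts t0] := single_homotopy s.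
apply: (eq_bij (minimal_homotopy_bij t i minX)) => x /=.
by rewrite ts t0 ?linear0 ?add0r // -subr_eq0 opprD addNKr oppr_eq0.
Qed.

Lemma complex_exact X (i j k : int) :
  i + e = j -> j + e = k -> zero_module (complex_homology X j) ->
  forall x, cdiff X j k x = 0 <-> exists y, cdiff X i j y = x.
Proof.
move=> ij <- /homology_zero_exact ex x.
have -> : i = j - e by rewrite -ij addrK.
by split=> [/ex //|[y <-]]; rewrite cdiff_cdiff.
Qed.

(** * Covers by cokernel projections, envelopes by kernel inclusions *)

Lemma coker_precover (F : module_class R) X i :
  (forall A, F A -> zero_module (Ext1 A (immod (cdiff X (i - e) i)))) ->
  F (X i) -> is_precover F (coker_proj (cdiff X (i - e) i)).
Proof.
move=> E FX; split=> // P' phi' FP'.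
apply: (lift_exact (j := cdiff X (i - e) i)) (E _ FP') _ _ => [x|m].
  by apply: (iff_trans (quotmod_proj_eq0 _ _)); split=> /asboolP.
by exists (repr (phi' m)); apply: reprK.
Qed.

Lemma ker_preenvelope (C : module_class R) X i :
  (forall A, C A -> zero_module (Ext1 (immod (cdiff X i (i + e))) A)) ->
  C (X i) -> is_preenvelope C (ker_incl (cdiff X i (i + e))).
Proof.
move=> E CX; split=> // Q' phi' CQ'.
apply: (extend_exact (q := cdiff X i (i + e))) (E _ CQ') _ _ => [x|v v0].
  split=> [/eqP x0|[v <-]]; last exact: ker_inclK.
  by exists (Sub x x0).
have -> : v = 0 by apply: val_inj.
exact: linear0.
Qed.

(** An endomorphism [f] over the cokernel is [1 + d s], where [s] lifts [f - 1]
through the differential into [X i], whose kernel is a boundary module because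
the homology at [i - e] vanishes. *)
Lemma minimal_coker_cover (F : module_class R) X i :
  e != 0 -> minimal X -> zero_module (complex_homology X (i - e)) ->
  (forall j A, F A -> zero_module (Ext1 A (immod (cdiff X j (j + e))))) ->
  F (X i) -> is_cover F (coker_proj (cdiff X (i - e) i)).
Proof.
move=> e0 minX H0 E FX; split.
  apply: coker_precover => // A FA.
  by have := E (i - e) A FA; rewrite subrK.
move=> f fE.
have [s sE] : exists s : {linear X i -> X (i - e)},
    forall x, cdiff X (i - e) i (s x) = (f \- idfun) x.
  apply: (lift_exact (j := cdiff X (i - e - e) (i - e))).
  - by have := E (i - e - e) _ FX; rewrite subrK.
  - by apply: complex_exact; rewrite ?subrK.
  - move=> x; apply/asboolP.
    apply/(quotmod_proj_eq0 (im_pred (cdiff X (i - e) i)) (f x - x)).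
    by rewrite linearB; apply/eqP; rewrite subr_eq0; apply/eqP/fE.
apply: (eq_bij (minimal_bij_out s e0 minX)) => x.
by rewrite sE /= addrC subrK.
Qed.

(** An endomorphism [f] under the kernel is [1 + s d], where [s] extends
[f - 1], regarded as a map on [im d], along the inclusion of [im d] into
[X (i + e)]; the cokernel of this inclusion is a boundary module because the
homology at [i + e] vanishes. *)
Lemma minimal_ker_envelope (C : module_class R) X i :
  e != 0 -> minimal X -> zero_module (complex_homology X (i + e)) ->
  (forall j A, C A -> zero_module (Ext1 (immod (cdiff X j (j + e))) A)) ->
  C (X i) -> is_envelope C (ker_incl (cdiff X i (i + e))).
Proof.
move=> e0 minX H0 E CX; split.
  by apply: ker_preenvelope => // A; apply: E.
move=> f fE.
have [s sE] : exists s : {linear X (i + e) -> X i},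
    forall x, s (cdiff X i (i + e) x) = (f \- idfun) x.
  apply: (extend_exact (q := cdiff X (i + e) (i + e + e))).
  - exact: E.
  - exact: complex_exact.
  - move=> x /eqP x0; have := fE (Sub x x0).
    by rewrite /= => ->; rewrite subrr.
apply: (eq_bij (minimal_bij_in s e0 minX)) => x.
by rewrite sE /= addrC subrK.
Qed.

End Complexes.

(** * The supremum of the degrees with nonzero homology *)

(** [supremum] takes its default value on a nonempty set without least upper
bound, so its existence has to be shown: it is the maximum if the set is bounded
above by an integer, and [+oo] otherwise. *)
Lemma int_supremums_neq0 (A : set int) (j0 : int) :
  A j0 -> (supremums [set (j%:E)%E | j in A] !=set0)%classic.
Proof.
move=> A0.
have [[n ubn]|unb] := pselect (exists n : int, forall j, A j -> j <= n).
  have exk : exists k : nat, `[< A (n - k%:Z) >].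
    exists `|n - j0|%N; apply/asboolP.
    by rewrite gez0_abs ?subr_ge0 ?ubn // subKr.
  case: (ex_minnP exk) => k /asboolP Ak mink.
  exists ((n - k%:Z)%:E)%E; split=> [_ [j Aj <-]|y];
    last by apply; exists (n - k%:Z).
  rewrite lee_fin.
  have jE : j = n - Posz `|n - j|%N by rewrite gez0_abs ?subr_ge0 ?ubn // subKr.
  by rewrite [leLHS]jE lerD2l lerN2 lez_nat mink // -jE; apply/asboolP.
exists +oo%E; split=> [_ [j _ <-]|[y||] uby //]; first exact: leey.
  case: unb; exists y => j Aj.
  by rewrite -lee_fin; apply: uby; exists j.
by have := uby _ (ex_intro2 _ _ j0 A0 erefl).
Qed.

Lemma homology_sup_zero (R : comPzRingType) (e : int) (X : complex R e)
    (i j : int) :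
  (homology_sup X <= i%:E)%E -> i < j -> zero_module (complex_homology X j).
Proof.
move=> supi ij; apply: contrapT => Hj.
pose A := [set k | ~ zero_module (complex_homology X k)]%classic.
have Aj : A j by [].
have : (j%:E <= homology_sup X)%E.
  by apply: ge_supremum_Nmem; [exact: int_supremums_neq0 Aj | exists j].
by move=> /le_trans/(_ supi); rewrite lee_fin leNgt ij.
Qed.

Theorem proposition4p3 (R : comPzRingType) (F C : module_class R) :
  noetherian R -> cotorsion_pair F C ->
  (forall X : chain_complex R,
     minimal X ->
     (forall i : int, F (X i)) ->
     (forall i : int, C (immod (cdiff X i (i - 1)))) ->
     (forall i : int, is_precover F (coker_proj (cdiff X (i + 1) i))) /\
     (forall i : int, (homology_sup X <= i%:E)%E ->
        is_cover F (coker_proj (cdiff X (i + 1) i)))) /\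
  (forall Y : cochain_complex R,
     minimal Y ->
     (forall i : int, C (Y i)) ->
     (forall i : int, F (immod (cdiff Y i (i + 1)))) ->
     (forall i : int, is_preenvelope C (ker_incl (cdiff Y i (i + 1)))) /\
     (forall i : int, (homology_sup Y <= i%:E)%E ->
        is_envelope C (ker_incl (cdiff Y i (i + 1))))).
Proof.
move=> _ [_ _ _ perpC].
have Ext0 M A : F M -> C A -> zero_module (Ext1 M A).
  by move=> FM /perpC; apply.
split=> [X minX FX CX|Y minY CY FY]; split=> i.
- have -> : i + 1 = i - (-1) by rewrite opprK.
  apply: coker_precover => // A FA; apply: Ext0 => //.
  by have := CX (i - (-1)); rewrite subrK.
- move=> supi; have -> : i + 1 = i - (-1) by rewrite opprK.
  apply: minimal_coker_cover => // [|j A FA]; last exact: Ext0.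
  by apply: (homology_sup_zero supi); rewrite opprK ltzD1.
- by apply: ker_preenvelope => // A; apply: Ext0.
- move=> supi; apply: minimal_ker_envelope => // [|j A]; last exact: Ext0.
  by apply: (homology_sup_zero supi); rewrite ltzD1.
Qed.
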